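(* Let $F$ be a field, $\mathcal{L}=(L_1,\dots,L_s)$ a tuple of pairwise disjoint finite subsets of $F\setminus\{0\}$, and $\kappa=(k_1,\dots,k_s)$ an $s$-tuple of positive integers. There is an integer $Q_\kappa$ such that for all $r\ge Q_\kappa$, \[ \mathrm{aex}_{\mathcal{L}}(r,\kappa)=\begin{cases}\binom{r}{\kappa} & \text{if every } L_i \text{ is a singleton } \{\ell_i\},\\[2pt] \binom{r-1}{\kappa}\mathcal{L}^\kappa & \text{otherwise.}\end{cases} \] Moreover, for any set of $(\mathcal{L},\kappa)$-vectors of affine rank at most $r$ and of size $\mathrm{aex}_{\mathcal{L}}(r,\kappa)$, there is a set $P$ of $r$ coordinate positions (respectively $r-1$ positions, in the second case) such that every vector in the set is zero outside $P$.
   Context: A vector over $F$ is an $(\mathcal{L},\kappa)$-vector if for each $i$ exactly $k_i$ of its entries lie in $L_i$ and all other entries are $0$. An $a$-dependence among vectors $\mathbf{v}_1,\dots,\mathbf{v}_m$ is a nontrivial linear dependence $\sum_j c_j\mathbf{v}_j=0$ with $\sum_j c_j=0$ in $F$. The affine rank ($a$-rank) of a set of vectors is the smallest $r$ such that every $r+1$ of the vectors admit an $a$-dependence. $\mathrm{aex}_{\mathcal{L}}(r,\kappa)$ denotes the maximum size of a set of $(\mathcal{L},\kappa)$-vectors over $F$ (all of the same length) of affine rank at most $r$. $\binom{n}{\kappa}=\frac{n!}{k_1!\cdots k_s!(n-\sum_i k_i)!}$ (zero if $\sum_ik_i>n$) and $\mathcal{L}^\kappa=\prod_i|L_i|^{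k_i}$.
   Formalization: In the ''moreover'' part, s ≥ 1 and all L_i nonempty are assumed; otherwise the extremal sets are the empty set or {0}, which exist in every length, so r (or r−1) coordinate positions need not exist. *)

(* Defs.v *)
From mathcomp Require Import all_boot all_order all_algebra.
From mathcomp Require Import finmap boolp.

Set Implicit Arguments.
Unset Strict Implicit.
Unset Printing Implicit Defensive.

Import GRing.Theory.
Local Open Scope ring_scope.
Local Open Scope fset_scope.

Definition Lk_vector (F : fieldType) (s : nat) (L : 'I_s -> {fset F})
    (k : 'I_s -> nat) (n : nat) (v : 'rV[F]_n) : Prop :=
  (forall i : 'I_s, #|[set j : 'I_n | v 0 j \in L i]| = k i) /\
  (forall j : 'I_n, v 0 j = 0 \/ exists i : 'I_s, v 0 j \in L i).

Definition a_dependent (F : fieldType) (n : nat) (T : {fset 'rV[F]_n}) : Prop :=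
  exists c : 'rV[F]_n -> F,
    [/\ exists2 v, v \in T & c v != 0,
        \sum_(v <- T) c v *: v = 0
      & \sum_(v <- T) c v = 0].

Definition all_a_dependent (F : fieldType) (n : nat) (X : {fset 'rV[F]_n})
    (m : nat) : Prop :=
  forall T : {fset 'rV[F]_n}, T `<=` X -> #|` T| = m -> a_dependent T.

Lemma arank_exists (F : fieldType) (n : nat) (X : {fset 'rV[F]_n}) :
  exists r : nat, `[< all_a_dependent X r.+1 >].
Proof.
exists #|` X|; apply/asboolP => T /fsubset_leq_card leTX cardT.
by rewrite cardT ltnn in leTX.
Qed.

Definition arank (F : fieldType) (n : nat) (X : {fset 'rV[F]_n}) : nat :=
  ex_minn (arank_exists X).

(* A finite set loses no generality here: since the [L i] are finite, there are
   only finitely many vectors of this kind of any given length. *)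
Definition Lk_family (F : fieldType) (s : nat) (L : 'I_s -> {fset F})
    (k : 'I_s -> nat) (r n : nat) (X : {fset 'rV[F]_n}) : Prop :=
  (forall v, v \in X -> Lk_vector L k v) /\ (arank X <= r)%N.

(* [is_aex L r k m] reads "aex_L(r, k) = m". The length of the vectors is not
   bounded in terms of [r], so the maximum ranges over every length [n]. *)
Definition is_aex (F : fieldType) (s : nat) (L : 'I_s -> {fset F}) (r : nat)
    (k : 'I_s -> nat) (m : nat) : Prop :=
  (exists (n : nat) (X : {fset 'rV[F]_n}), Lk_family L k r X /\ #|` X| = m) /\
  (forall (n : nat) (X : {fset 'rV[F]_n}), Lk_family L k r X -> (#|` X| <= m)%N).

Definition multinom (s : nat) (n : nat) (k : 'I_s -> nat) : nat :=
  if (\sum_i k i <= n)%N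
  then (n`! %/ ((\prod_i (k i)`!) * (n - \sum_i k i)`!))%N
  else 0%N.

Definition Lpow (F : fieldType) (s : nat) (L : 'I_s -> {fset F})
    (k : 'I_s -> nat) : nat :=
  (\prod_i #|` L i| ^ k i)%N.

Definition all_singletons (F : fieldType) (s : nat) (L : 'I_s -> {fset F}) : bool :=
  [forall i, #|` L i| == 1%N].

(* Main.v *)
Require Import Defs.
From mathcomp Require Import all_boot all_order all_fingroup all_algebra.
From mathcomp Require Import finmap boolp zify ring.

(** Affine rank at most [r] yields a set [B] of at most [r - 1] coordinates
    such that every other coordinate [x_j] is, on the family [X], an affine form
    [f_j] in the coordinates of [B]; in particular vectors of [X] are determined
    by their restriction to [B].  Call a vector full if it is supported in [B].
    There are at most [N(m) = multinom m k * Lpow] full vectors, [m = #|B|], and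
    only [O(m^(K-1))] others, [K] being the weight.

    A full vector of [X] is a zero of every [f_j].  If some [f_j] has different
    coefficients at [b] and [b'], then swapping the entries at [b] and [b']
    shows that [f_j] is nonzero on at least as many full vectors as there are
    with [v_b <> 0 = v_b'].  To leading order this is
    [sum_i |L_i| N(m-2, k-e_i)], while [X] has at most
    [sum_i N(m-2, k-e_i) + O(m^(K-2))] vectors that are not full: [X] is smaller
    than [N(m+1)], and smaller than [N(m)] when some [|L_i| > 1].

    Otherwise each [f_j] is a constant plus a multiple of the coordinate sum.
    If some [|L_i| > 1] and some [f_j] is not zero on [X], changing one entry
    within [L_i] shows that [f_j] vanishes on at most half of the full vectors.
    In general, if [X] has a full vector then the [f_j] are all multiples of a
    single form, hence the outer coordinates of a vector are all nonzero or all
    zero as soon as their multiples are nonzero: either only one outer coordinate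
    occurs, or the vectors of [X] that are not full number [O(m^(K-2))]. *)

Set Implicit Arguments.
Unset Strict Implicit.
Unset Printing Implicit Defensive.

Import GRing.Theory.

(** * Counting vectors of a given type *)

(* A vector is a map [T -> option C]: [None] stands for the entry 0, and
   [tau c = i] means that the nonzero value [c] lies in [L i]. *)
Section Coloured.

Variables (s : nat) (C : finType) (tau : C -> 'I_s).

Definition colour_mult (i : 'I_s) : nat := #|[pred c | tau c == i]|.

Section Vectors.

Variable T : finType.
Implicit Types (v w : {ffun T -> option C}) (B : {set T}) (k : 'I_s -> nat).

Definition colour_count v (i : 'I_s) : nat := #|[set t | omap tau (v t) == Some i]|.

Definition supp v : {set T} := [set t | v t != None].

Definition update v (b : T) (d : option C) : {ffun T -> option C} :=
  [ffun t => if t == b then d else v t].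

Definition restrict B v : {ffun T -> option C} :=
  [ffun t => if t \in B then v t else None].

Definition typed_set B k : {set {ffun T -> option C}} :=
  [set v | [forall i, colour_count v i == k i] && (supp v \subset B)].

(* The type [k - e_i]; equal to [k] when [k i = 0]. *)
Definition lower_type k (i : 'I_s) : 'I_s -> nat := fun i' => k i' - (i' == i).

Lemma typed_setP B k v :
  reflect ((forall i, colour_count v i = k i) /\ (forall t, t \notin B -> v t = None))
    (v \in typed_set B k).
Proof.
rewrite inE; apply: (iffP andP) => -[H1 H2]; split.
- by move=> i; apply/eqP/(forallP H1).
- move=> t tB; apply/eqP; apply: contraNT tB => vt.
  by apply: (subsetP H2); rewrite inE.
- by apply/forallP => i; rewrite H1.
- apply/subsetP => t; rewrite inE; apply: contraNT => /H2 ->; exact: eqxx.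
Qed.

Lemma card_supp v : #|supp v| = \sum_i colour_count v i.
Proof.
rewrite -sum1_card.
transitivity (\sum_(t in supp v) \sum_i (omap tau (v t) == Some i)%N).
  apply: eq_bigr => t; rewrite inE; case: (v t) => //= c _.
  by rewrite (bigD1 (tau c)) //= eqxx big1 // => i /negPf ni; rewrite eq_sym [_ == _]ni.
rewrite exchange_big; apply: eq_bigr => i _ /=.
rewrite /colour_count -sum1_card big_mkcond [RHS]big_mkcond /=; apply: eq_bigr => t _.
by rewrite !inE; case: (v t) => [c|] //=; case: ifP.
Qed.

Lemma sum_lower k i : 0 < k i -> (\sum_j lower_type k i j).+1 = \sum_j k j.
Proof.
move=> ki; rewrite (bigD1 i) //= [RHS](bigD1 i) //= /lower_type eqxx -addSn.
congr (_ + _); first by rewrite subn1 prednK.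
by apply: eq_bigr => j /negPf ->; rewrite subn0.
Qed.

Lemma colour_count_update v b c i :
  v b = None -> colour_count (update v b (Some c)) i = colour_count v i + (tau c == i).
Proof.
move=> vb; rewrite /colour_count -!sum1_card !(big_mkcond (fun t => t \in _)) /=.
rewrite (bigD1 b) //= [in RHS](bigD1 b) //= !inE ffunE eqxx vb /= add0n addnC.
congr (_ + _).
by apply: eq_bigr => t /negPf tb; rewrite !inE ffunE tb.
Qed.

Lemma update_update v b d d' : update (update v b d) b d' = update v b d'.
Proof. by apply/ffunP => t; rewrite !ffunE; case: (t == b). Qed.

Lemma update_id v b : update v b (v b) = v.
Proof. by apply/ffunP => t; rewrite !ffunE; case: eqP => [->|]. Qed.

Lemma update_eq v b d : update v b d b = d.
Proof. by rewrite ffunE eqxx. Qed.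

(** Erasing the entry at [b] is a bijection onto the vectors of the lowered type on [B]. The guard
    [0 < k (tau c)] is there because truncated subtraction would leave [k] unchanged. *)
Lemma card_typed_set_colour B k b c : b \notin B ->
  #|[set v in typed_set (b |: B) k | v b == Some c]| =
  if 0 < k (tau c) then #|typed_set B (lower_type k (tau c))| else 0.
Proof.
move=> bB; case: ifPn => [kc|]; last first.
  rewrite -eqn0Ngt => /eqP kc; apply/eqP; rewrite cards_eq0; apply/eqP/setP => v.
  rewrite in_set in_set0; apply/negP => /andP[/typed_setP[H _] /eqP vb].
  move: (H (tau c)); rewrite kc => /eqP; rewrite cards_eq0 => /eqP /setP /(_ b).
  by rewrite !inE vb /= eqxx.
have inj : {in typed_set B (lower_type k (tau c)) &, injective (fun v => update v b (Some c))}.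
  move=> v w /typed_setP[_ /(_ _ bB) vb] /typed_setP[_ /(_ _ bB) wb] E.
  by rewrite -(update_id v b) -(update_id w b) vb wb -(update_update v b (Some c)) E update_update.
rewrite -(card_in_imset inj); apply: eq_card => v; apply/idP/imsetP.
  rewrite in_set => /andP[/typed_setP[H1 H2] /eqP vb].
  exists (update v b None); last by rewrite update_update -vb update_id.
  apply/typed_setP; split=> [i|t tB].
    have := colour_count_update c i (update_eq v b None); rewrite update_update -vb update_id H1 /lower_type eq_sym.
    by move=> ->; rewrite addnK.
  by rewrite ffunE; case: eqP => // /eqP tb; apply: H2; rewrite !inE negb_or tb.
move=> [w /typed_setP[H1 H2] ->]; rewrite in_set update_eq eqxx andbT; apply/typed_setP; split=> [i|t].
  rewrite colour_count_update ?H2 // H1 /lower_type [tau c == i]eq_sym subnK //.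
  by case: eqP => // ->.
by rewrite !inE negb_or ffunE => /andP[/negPf -> /H2].
Qed.

Lemma card_typed_set_nonzero B k b : b \notin B ->
  #|[set v in typed_set (b |: B) k | v b != None]| =
  \sum_i colour_mult i * (if 0 < k i then #|typed_set B (lower_type k i)| else 0).
Proof.
move=> bB; transitivity (\sum_c #|[set v in typed_set (b |: B) k | v b == Some c]|).
  rewrite -sum1_card (partition_big (fun v => v b) (fun d => d != None)); last first.
    by move=> v; rewrite inE => /andP[].
  rewrite (reindex_omap (@Some C) id) /=; last by case.
  rewrite [LHS](eq_bigl predT); last by move=> c; rewrite /= eqxx.
  apply: eq_bigr => c _; rewrite -sum1_card; apply: eq_bigl => v.
  by rewrite !in_set; case: (v b) => [d|] /=; rewrite ?andbF ?andbT.
rewrite (partition_big tau predT) //=; apply: eq_bigr => i _.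
rewrite (eq_bigr (fun _ => if 0 < k i then #|typed_set B (lower_type k i)| else 0)); last first.
  by move=> c /eqP <-; rewrite card_typed_set_colour.
by rewrite sum_nat_const.
Qed.

(** Pascal's rule for typed vectors: split according to whether the entry at [b] is zero. *)
Lemma card_typed_setU1 B k b : b \notin B ->
  #|typed_set (b |: B) k| = #|typed_set B k| +
  \sum_i colour_mult i * (if 0 < k i then #|typed_set B (lower_type k i)| else 0).
Proof.
move=> bB; rewrite -(card_typed_set_nonzero _ bB).
rewrite -(cardsID [set v : {ffun T -> option C} | v b != None] (typed_set _ _)) addnC.
congr (_ + _); apply: eq_card => v; last by rewrite in_setI [RHS]in_set [X in _ && X]in_set.
rewrite in_setD [X in ~~ X && _]in_set.
apply/andP/idP => [[/negPn/eqP vb /typed_setP[H1 H2]]|/typed_setP[H1 H2]].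
  apply/typed_setP; split=> // t tB; case: (eqVneq t b) => [->//|tb].
  by apply: H2; rewrite !inE negb_or tb.
split; first by rewrite H2 //.
by apply/typed_setP; split=> // t; rewrite !inE negb_or => /andP[_ /H2].
Qed.

Lemma typed_set_set0 k : #|typed_set set0 k| = (\sum_i k i == 0).
Proof.
have sub0 v : supp v \subset set0 -> v = [ffun=> None].
  move=> H; apply/ffunP => t; rewrite ffunE; apply/eqP.
  by apply: contraTT H => vt; apply/subsetPn; exists t; rewrite !inE.
have c0 i : colour_count [ffun=> None] i = 0.
  by apply/eqP; rewrite cards_eq0; apply/eqP/setP => t; rewrite !inE ffunE.
case: eqP => [/eqP K0|K0].
  apply/eqP/cards1P; exists [ffun=> None]; apply/setP => v; rewrite in_set1.
  apply/typed_setP/eqP => [[_ H]|->]; first by apply/ffunP => t; rewrite H ?inE ?ffunE.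
  split=> [i|t]; last by rewrite ffunE.
  by move: K0; rewrite sum_nat_eq0 => /forall_inP /(_ i isT) /eqP ->.
apply/eqP; rewrite cards_eq0; apply/eqP/setP => v; rewrite in_set0; apply/negP.
case/typed_setP => [H1 H2]; case: K0; apply: big1 => i _; rewrite -H1 (sub0 v) ?c0 //.
by apply/subsetP => t; rewrite inE; apply: contraNT => /H2 ->; exact: eqxx.
Qed.

Lemma set_card_ind (P : {set T} -> Prop) :
  P set0 -> (forall b B, b \notin B -> P B -> P (b |: B)) -> forall B, P B.
Proof.
move=> P0 PS B; have [m] := ubnP #|B|; elim: m B => // m IHm B.
have [->//|/set0Pn[b bB]] := eqVneq B set0; rewrite (cardsD1 b) bB => Bm.
by rewrite -(setD1K bB); apply: PS; [rewrite !inE eqxx | apply: IHm].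
Qed.

(** The multinomial count in product form, free of division. The induction on [B] keeps [k] general
    because the recurrence lowers it. *)
Lemma card_typed_set_fact B k :
  if \sum_i k i <= #|B|
  then #|typed_set B k| * ((\prod_i (k i)`!) * (#|B| - \sum_i k i)`!) =
       (#|B|)`! * \prod_i colour_mult i ^ k i
  else #|typed_set B k| = 0.
Proof.
elim/set_card_ind: B k => [|b B bB IH] k.
  rewrite typed_set_set0 cards0; case: ifP; rewrite leqn0 => H; last by rewrite H.
  rewrite H sub0n fact0 !mul1n muln1; move: H; rewrite sum_nat_eq0.
  by move=> /forall_inP H; apply: eq_bigr => i _; rewrite (eqP (H i isT)).
have IHi i : 0 < k i -> (if \sum_j k j <= #|B|.+1 then
   #|typed_set B (lower_type k i)| * colour_mult i * ((\prod_j (k j)`!) * (#|B|.+1 - \sum_j k j)`!) =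
   k i * ((#|B|)`! * \prod_j colour_mult j ^ k j)
   else #|typed_set B (lower_type k i)| = 0).
  move=> ki; have := IH (lower_type k i); rewrite -(sum_lower ki) ltnS subSS.
  case: ifP => // _ E.
  have -> : \prod_j (k j)`! = k i * \prod_j (lower_type k i j)`!.
    rewrite (bigD1 i) //= [in RHS](bigD1 i) //= /lower_type eqxx mulnA; congr (_ * _).
      by rewrite subn1; case: (k i) ki => // p _; rewrite factS.
    by apply: eq_bigr => j /negPf ->; rewrite subn0.
  have -> : \prod_j colour_mult j ^ k j = colour_mult i * \prod_j colour_mult j ^ lower_type k i j.
    rewrite (bigD1 i) //= [in RHS](bigD1 i) //= /lower_type eqxx mulnA; congr (_ * _).
      by rewrite subn1; case: (k i) ki => // p _; rewrite expnS.
    by apply: eq_bigr => j /negPf ->; rewrite subn0.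
  transitivity (k i * colour_mult i * (#|typed_set B (lower_type k i)| *
    (\prod_j (lower_type k i j)`! * (#|B| - \sum_j lower_type k i j)`!))); first by ring.
  rewrite E; ring.
rewrite cardsU1 bB add1n card_typed_setU1 //; move: (IH k).
case: (ltngtP (\sum_i k i) #|B|.+1) => [KB|KB|KB]; last first.
- rewrite KB ltnn => -> /=; rewrite subnn muln1 add0n big_distrl /=.
  rewrite factS -mulnA -[in RHS]KB big_distrl /=; apply: eq_bigr => i _.
  case: ifP => ki; last by rewrite muln0; move/negbT: ki; rewrite -eqn0Ngt => /eqP ->.
  have := IHi i ki; rewrite KB leqnn subnn muln1 => <-; ring.
- rewrite leqNgt (ltnW KB) /= => ->; rewrite add0n big1 // => i _.
  by case: ifP => ki; rewrite ?muln0 //; have := IHi i ki; rewrite leqNgt KB => -> ; rewrite muln0.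
rewrite -ltnS KB => E; rewrite subSn // factS mulnDl.
have -> : #|typed_set B k| * (\prod_i (k i)`! * ((#|B| - \sum_i k i).+1 * (#|B| - \sum_i k i)`!)) =
   (#|B|.+1 - \sum_i k i) * ((#|B|)`! * \prod_i colour_mult i ^ k i).
  by rewrite -E subSn //; ring.
(* Write [#|B|.+1] as [(#|B|.+1 - K) + K] with [K] the sum of the [k i]: the first part matches the
   vectors that vanish at [b], the summand [k i] of the second those with an entry of class [i] at
   [b]. *)
rewrite factS -mulnA -{2}(subnK (ltnW KB)) mulnDl; congr (_ + _).
rewrite !big_distrl /=; apply: eq_bigr => i _.
case: ifP => ki; last by rewrite muln0; move/negbT: ki; rewrite -eqn0Ngt => /eqP ->.
by have := IHi i ki; rewrite (ltnW KB) subSn // factS => <-; ring.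
Qed.

End Vectors.
End Coloured.

Lemma ncol_id s (i : 'I_s) : colour_mult id i = 1.
Proof. by rewrite /colour_mult (@eq_card _ _ (pred1 i)) ?card1. Qed.

(** Divisibility comes from counting: with the indices themselves as colours every class has one
    colour, and the number of typed vectors is the quotient. *)
Lemma multinom_fact s (k : 'I_s -> nat) (m : nat) : \sum_i k i <= m ->
  multinom m k * ((\prod_i (k i)`!) * (m - \sum_i k i)`!) = m`!.
Proof.
move=> Km; rewrite /multinom Km; apply: divnK; apply/dvdnP.
have := card_typed_set_fact id [set: 'I_m] k; rewrite cardsT card_ord Km => E.
exists #|typed_set id [set: 'I_m] k|; rewrite E big1 ?muln1 // => i _.
by rewrite ncol_id exp1n.
Qed.

(** The left side has degree below [q] in [m], the binomial has degree [q]. All error terms are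
    absorbed through this comparison. *)
Lemma bin_growth (A D q : nat) :
  exists Q, forall m, Q <= m -> A * \sum_(p < q) (m * D) ^ p < 'C(m - 2, q).
Proof.
elim: q A => [|q IH] A; first by exists 0 => m _; rewrite big_ord0 muln0 bin0.
(* For [m >= 2 * q + 4] one has [m * 'C(m - 2, q) <= 2 * q.+1 * 'C(m - 2, q.+1)], which dictates
   this constant; the bound [2 * q.+1 * A < m] takes care of the term [p = 0]. *)
have [Q HQ] := IH (2 * A * D * q.+1).
exists (maxn Q (maxn (2 * q + 4) (2 * q.+1 * A).+1)) => m.
rewrite !geq_max => /and3P[/HQ]; set S := \sum_(i < q) _ => H1 H2 H3.
have -> : \sum_(p < q.+1) (m * D) ^ p = 1 + m * D * S.
  by rewrite big_ord_recl expn0 big_distrr; congr (_ + _); apply: eq_bigr => i _;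
    rewrite lift0 expnS.
have := mul_bin_left (m - 2) q; move: H1.
set x := 'C(_, q); set y := 'C(_, q.+1) => H1 E.
have H4 : m * x <= 2 * (q.+1 * y).
  by rewrite E mulnA leq_mul2r; apply/orP; right; lia.
have H5 : m * (2 * A * D * q.+1 * S).+1 <= m * x by rewrite leq_mul2l H1 orbT.
rewrite -(@ltn_pmul2l (2 * q.+1)) //.
apply: leq_trans (_ : m * (2 * A * D * q.+1 * S).+1 <= _); last by lia.
nia.
Qed.

(** * Polynomial estimates for the number of vectors *)

Section Counting.

Variables (s : nat) (C : finType) (tau : C -> 'I_s).

Definition Lk_count (k : 'I_s -> nat) (m : nat) : nat :=
  multinom m k * \prod_i colour_mult tau i ^ k i.

(** The error term: an upper bound for the number of vectors of weight below [q] on [m]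
    positions. *)
Definition geom_sum (m q : nat) : nat := \sum_(p < q) (m * #|C|) ^ p.

Section Vectors.

Variable T : finType.
Implicit Types (v w : {ffun T -> option C}) (B : {set T}) (k : 'I_s -> nat).

Lemma card_typed_set B k : #|typed_set tau B k| = Lk_count k #|B|.
Proof.
have := card_typed_set_fact tau B k; rewrite /Lk_count; case: ifP => [KB|KB ->]; last first.
  by rewrite /multinom KB.
move=> E; have P_gt0 : 0 < \prod_i (k i)`! * (#|B| - \sum_i k i)`!.
  by rewrite muln_gt0 fact_gt0 andbT; apply/prodn_gt0 => i; rewrite fact_gt0.
by apply/eqP; rewrite -(eqn_pmul2r P_gt0) E -(multinom_fact KB); apply/eqP; ring.
Qed.

(** Compare Pascal's rule with [card_typed_setU1], of whose sum a single class [i] with [k i > 0] is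
    enough. *)
Lemma bin_le_card_typed_set B k : (forall i, 0 < colour_mult tau i) ->
  'C(#|B|, \sum_i k i) <= #|typed_set tau B k|.
Proof.
move=> c_gt0; elim/set_card_ind: B k => [|b B bB IH] k.
  by rewrite cards0 typed_set_set0 bin0n.
rewrite cardsU1 bB add1n card_typed_setU1 //.
case E: (\sum_i k i) => [|K]; first by rewrite bin0 (leq_trans _ (leq_addr _ _)) // -(bin0 #|B|) -E.
rewrite binS leq_add // -?E //.
have [i ki] : exists i, 0 < k i.
  by apply/existsP; apply: contra_eqT E; rewrite negb_exists => /forallP H;
    rewrite big1 // => i _; apply/eqP; rewrite eqn0Ngt H.
rewrite (bigD1 i) //= ki (leq_trans _ (leq_addr _ _)) //.
have -> : K = \sum_j lower_type k i j by apply: succn_inj; rewrite sum_lower.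
by rewrite (leq_trans (IH _)) // leq_pmull.
Qed.

Definition weight_set B (q : nat) : {set {ffun T -> option C}} :=
  [set v | (supp v \subset B) && (#|supp v| == q)].

Lemma supp_upd_None v b : supp (update v b None) = supp v :\ b.
Proof.
by apply/setP => t; rewrite !inE ffunE; case: (t == b); rewrite ?eqxx.
Qed.

Lemma weight_set_updP B q b v : v \in weight_set B q -> v b != None ->
  exists2 u, u \in setX [set: C] (weight_set B q.-1) & v = update u.2 b (Some u.1).
Proof.
rewrite in_set => /andP[vB /eqP vq] vb; have bv : b \in supp v by rewrite inE.
case E: (v b) vb => [c|] // _; exists (c, update v b None); last first.
  by rewrite /= update_update -E update_id.
rewrite in_setX in_setT in_set supp_upd_None /= (subset_trans (subsetDl _ _) vB) /=.
by rewrite -vq (cardsD1 b (supp v)) bv.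
Qed.

(** A vector of weight [q] arises from one of weight [q - 1] by choosing a position and a colour. *)
Lemma card_weight_set B q : #|weight_set B q| <= (#|B| * #|C|) ^ q.
Proof.
elim: q => [|q IH].
  rewrite expn0 -(cards1 ([ffun=> None] : {ffun T -> option C})) subset_leq_card //.
  apply/subsetP => v; rewrite in_set in_set1 cards_eq0 => /andP[_ /eqP v0].
  apply/eqP/ffunP => t; rewrite ffunE; apply/eqP; apply/negPn.
  by move/setP: v0 => /(_ t); rewrite !inE => ->.
rewrite expnS (leq_trans _ (leq_mul (leqnn _) IH)) //.
rewrite -mulnA -[#|C|]cardsT -!cardsX.
apply: leq_trans (leq_imset_card (fun u : T * (C * {ffun T -> option C}) =>
  update u.2.2 u.1 (Some u.2.1)) _).
apply: subset_leq_card; apply/subsetP => v vS; move: (vS); rewrite in_set => /andP[vB vq].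
have /card_gt0P[b bv] : 0 < #|supp v| by rewrite (eqP vq).
have [|u uS ->] := weight_set_updP (b := b) vS; first by rewrite inE in bv.
by apply/imsetP; exists (b, u) => //; rewrite in_setX uS (subsetP vB).
Qed.

(** Prescribing one position of the support saves a factor [#|B|], so that such vectors can be
    counted as error. *)
Lemma card_weight_set_at B q b :
  #|[set v in weight_set B q | v b != None]| <= #|C| * geom_sum #|B| q.
Proof.
case: q => [|q].
  rewrite /geom_sum big_ord0 muln0 leqn0 cards_eq0; apply/eqP/setP => v; rewrite in_set0 in_set in_set.
  by apply/negP => /andP[/andP[_]]; rewrite cards_eq0 => /eqP /setP /(_ b); rewrite !inE => ->.
apply: leq_trans (_ : #|C| * #|weight_set B q| <= _); last first.
  rewrite leq_mul2l (leq_trans (card_weight_set B q)) ?orbT //.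
  by rewrite /geom_sum big_ord_recr /= leq_addl.
rewrite -[#|C|]cardsT -cardsX.
apply: leq_trans (leq_imset_card (fun u : (C * {ffun T -> option C}) =>
  update u.2 b (Some u.1)) _).
apply: subset_leq_card; apply/subsetP => v; rewrite in_set => /andP[vS vb].
by have [u uS ->] := weight_set_updP vS vb; apply/imsetP; exists u.
Qed.

Lemma card_supp_lt B q :
  #|[set v : {ffun T -> option C} | (supp v \subset B) && (#|supp v| < q)]| <= geom_sum #|B| q.
Proof.
elim: q => [|q IH].
  by rewrite /geom_sum big_ord0 leqn0 cards_eq0; apply/eqP/setP => v; rewrite !inE andbF.
rewrite /geom_sum big_ord_recr /= -/(geom_sum _ _); apply: leq_trans (leq_add IH (card_weight_set B q)).
apply: leq_trans (leq_card_setU _ _); apply: subset_leq_card; apply/subsetP => v.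
by rewrite in_setU !in_set ltnS leq_eqVlt => /andP[-> /orP[->|->]]; rewrite ?orbT.
Qed.

End Vectors.

Lemma bin_le_Lk_count k m : (forall i, 0 < colour_mult tau i) ->
  'C(m, \sum_i k i) <= Lk_count k m.
Proof.
by move=> c0; rewrite -[m]card_ord -cardsT -card_typed_set bin_le_card_typed_set.
Qed.

Lemma Lk_countS k m : Lk_count k m.+1 = Lk_count k m +
   \sum_i colour_mult tau i * (if 0 < k i then Lk_count (lower_type k i) m else 0).
Proof.
pose B := [set: 'I_m.+1] :\ ord0.
have cB : #|B| = m by rewrite cardsCs setCD setCT set0U cards1 card_ord subn1.
have : #|ord0 |: B| = m.+1 by rewrite setD1K ?cardsT ?card_ord ?inE.
have := card_typed_setU1 tau k (_ : ord0 \notin B); rewrite !inE eqxx => /(_ isT).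
rewrite !card_typed_set cB => E1 E2; rewrite -E2 E1; congr (_ + _); apply: eq_bigr => i _.
by case: ifP => // _; rewrite card_typed_set cB.
Qed.

(** One class in the recurrence already gives this growth. Having degree one less than the weight,
    it outgrows the error terms of the next lower degree. *)
Lemma Lk_countS_ge k m : (forall i, 0 < colour_mult tau i) -> (forall i, 0 < k i) -> 0 < s ->
  Lk_count k m + 'C(m, (\sum_i k i).-1) <= Lk_count k m.+1.
Proof.
move=> c0 k0 s0; rewrite Lk_countS leq_add2l; pose i := Ordinal s0.
rewrite [leqRHS](bigD1 i) //= k0 (leq_trans _ (leq_addr _ _)) //.
rewrite -(sum_lower (k0 i)) /= (leq_trans (bin_le_Lk_count _ _ c0)) //.
by rewrite leq_pmull.
Qed.

Lemma leq_Lk_count k m n : m <= n -> Lk_count k m <= Lk_count k n.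
Proof.
move=> /subnK <-; elim: (n - m) => // d IH; rewrite addSn.
by rewrite (leq_trans IH) // Lk_countS leq_addr.
Qed.

End Counting.

Lemma next_neq (T : eqType) (p : seq T) (x : T) :
  uniq p -> x \in p -> 1 < size p -> next p x != x.
Proof.
move=> up xp; have [i q E] := rot_to xp.
rewrite -(next_rot i) // -(size_rot i p); move: up; rewrite -(rot_uniq i) E.
case: q {E} => [|y q] //= /andP[+ _] _.
by rewrite eqxx inE negb_or eq_sym => /andP[].
Qed.

(** * Families of vectors determined by few coordinates *)

Section Extremal.

Variables (F : fieldType) (s : nat) (C : finType) (tau : C -> 'I_s) (val : C -> F).
Hypothesis val_inj : injective val.
Hypothesis val_neq0 : forall c, val c != 0%R.

Definition ov (d : option C) : F := oapp val 0%R d.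

Lemma ov_inj : injective ov.
Proof.
move=> [c|] [d|] //= => [/val_inj ->//| E | E].
  by have := val_neq0 c; rewrite E eqxx.
by have := val_neq0 d; rewrite -E eqxx.
Qed.

Definition aff (T : finType) (B : {set T}) (a0 : F) (a : T -> F)
    (v : {ffun T -> option C}) : F :=
  (a0 + \sum_(t in B) a t * ov (v t))%R.

(** * Typed vectors on which an affine form does not vanish *)

Section FixedT.

Variable T : finType.
Implicit Types (v w : {ffun T -> option C}) (B : {set T}) (k : 'I_s -> nat).

Lemma aff_tperm B (a0 : F) (a : T -> F) v b b' :
  b \in B -> b' \in B -> b != b' -> v b' = None ->
  (aff B a0 a v - aff B a0 a [ffun t => v (tperm b b' t)] = (a b - a b') * ov (v b))%R.
Proof.
move=> bB b'B bb' vb'; rewrite /aff.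
rewrite (bigD1 b) //= (bigD1 b') /=; last by rewrite b'B eq_sym.
rewrite [X in (_ - (_ + X))%R](bigD1 b) //= [X in (_ - (_ + (_ + X)))%R](bigD1 b') /=; last by rewrite b'B eq_sym.
rewrite !ffunE tpermL tpermR vb' /=.
under [X in (_ - (_ + (_ + (_ + X))))%R]eq_bigr => t /andP[/andP[_ tb] tb'].
  rewrite ffunE tpermD 1?eq_sym //; over.
by ring.
Qed.

(** Send [v] to itself if the form is nonzero there, and otherwise to its swap, where the form is
    nonzero by [aff_tperm]. The entry at [b] tells the two kinds of image apart, so the map is
    injective. *)
Lemma swap_fail B k (a0 : F) (a : T -> F) b b' :
  b \in B -> b' \in B -> a b != a b' ->
  #|[set v in typed_set tau B k | (v b != None) && (v b' == None)]| <=
  #|[set v in typed_set tau B k | aff B a0 a v != 0%R]|.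
Proof.
move=> bB b'B aa; have bb' : b != b' by apply: contraNneq aa => ->.
pose sw v : {ffun T -> option C} := [ffun t => v (tperm b b' t)].
have swK : involutive sw by move=> v; apply/ffunP => t; rewrite !ffunE tpermK.
pose g v := if aff B a0 a v != 0%R then v else sw v.
set G := [set v in _ | _].
have GP v : v \in G -> [/\ v \in typed_set tau B k, v b != None & v b' = None].
  by rewrite in_set => /and3P[? ? /eqP].
have g_inj : {in G &, injective g}.
  move=> v w /GP[_ vb vb'] /GP[_ wb wb']; rewrite /g.
  case: ifP => _; case: ifP => _ // E; last exact: (can_inj swK).
    by move: vb; rewrite E ffunE tpermL wb'.
  by move: wb; rewrite -E ffunE tpermL vb'.
rewrite -(card_in_imset g_inj); apply: subset_leq_card; apply/subsetP => w.
case/imsetP => v /GP[vW vb vb'] ->; rewrite in_set /g; case: ifP => [->|/negbFE/eqP H].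
  by rewrite vW.
apply/andP; split; last first.
  have := aff_tperm a0 a bB b'B bb' vb'; rewrite H sub0r => E.
  rewrite -oppr_eq0 E mulf_neq0 ?subr_eq0 //.
  by case: (v b) vb => //= c _; exact: val_neq0.
case/typed_setP: vW => H1 H2; apply/typed_setP; split=> [i|t tB].
  rewrite -H1 /colour_count -[RHS](card_imset _ (@perm_inj _ (tperm b b'))); apply: eq_card => t.
  rewrite in_set; apply/idP/imsetP => [|[u + ->]].
    by rewrite ffunE => E; exists (tperm b b' t); rewrite ?tpermK ?inE.
  by rewrite inE ffunE tpermK.
rewrite ffunE tpermD ?H2 //; first by apply: contraNneq tB => <-.
by apply: contraNneq tB => <-.
Qed.

Lemma card_typed_set_nonzero_zero B k b b' : b \in B -> b' \in B -> b != b' ->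
  #|[set v in typed_set tau B k | (v b != None) && (v b' == None)]| =
  \sum_i colour_mult tau i * (if 0 < k i then #|typed_set tau (B :\ b' :\ b) (lower_type k i)| else 0).
Proof.
move=> bB b'B bb'; have bB'' : b \notin B :\ b' :\ b by rewrite !inE eqxx.
rewrite -(card_typed_set_nonzero _ _ bB'').
rewrite setD1K; last by rewrite !inE bb' bB.
apply: eq_card => v; apply/idP/idP; rewrite in_set.
  move=> /and3P[/typed_setP[H1 H2] vb /eqP vb']; rewrite in_set vb andbT; apply/typed_setP.
  by split=> // t; rewrite !inE negb_and negbK => /orP[/eqP ->|/H2].
move=> /andP[/typed_setP[H1 H2] vb]; rewrite in_set vb H2 ?eqxx ?andbT; last by rewrite !inE eqxx.
by apply/typed_setP; split=> // t tB; apply: H2; rewrite !inE negb_and tB orbT.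
Qed.

(** Replacing one entry by another value of the same class changes the coordinate sum. An injective
    choice of such a replacement maps the zeros of the form to non-zeros, so the zeros make up at
    most half. *)
Lemma shift_fail B k (a0 : F) (a : T -> F) (alpha : F) (i : 'I_s) :
  (forall t, t \in B -> a t = alpha) -> alpha != 0%R -> 0 < k i -> 1 < colour_mult tau i ->
  #|typed_set tau B k| <= 2 * #|[set v in typed_set tau B k | aff B a0 a v != 0%R]|.
Proof.
move=> aE alpha0 ki ci; pose e := enum [pred c | tau c == i].
have ue : uniq e := enum_uniq _.
have me c : (c \in e) = (tau c == i) by rewrite mem_enum.
(* A cyclic permutation of the colours of class [i], without fixed points there because the class
   has at least two. *)
pose sg c := if tau c == i then next e c else c.
have tau_sg c : tau (sg c) = tau c.
  rewrite /sg; case: ifP => // ic; move: (ic); rewrite -me -mem_next me => /eqP ->.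
  by rewrite (eqP ic).
have sg_inj : injective sg.
  move=> c d E; have := congr1 tau E; rewrite !tau_sg; move: E; rewrite /sg => E Et.
  by move: E; rewrite Et; case: ifP => // _ /(can_inj (prev_next ue)).
(* The chosen position depends only on the classes of the entries, which the shift preserves; this
   makes [sh] injective. *)
pose pos v := [pick t | omap tau (v t) == Some i].
pose sh v := if pos v is Some t then update v t (omap sg (v t)) else v.
have tau_sh v t : omap tau (sh v t) = omap tau (v t).
  rewrite /sh; case: (pos v) => // u; rewrite ffunE; case: eqP => // ->.
  by case: (v u) => //= c; rewrite tau_sg.
have pos_sh v : pos (sh v) = pos v by apply: eq_pick => t; rewrite tau_sh.
have sh_inj : injective sh.
  move=> v w E; have := pos_sh v; rewrite E pos_sh => Ep.
  move: E; rewrite /sh Ep; case: (pos v) => // u E.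
  apply/ffunP => t; have := congr1 (fun f : {ffun _} => f t) E; rewrite !ffunE.
  by case: eqP => // ->; case: (v u) (w u) => [c|] [d|] //= [/sg_inj ->].
have sh_W v : v \in typed_set tau B k -> sh v \in typed_set tau B k.
  case/typed_setP => H1 H2; apply/typed_setP; split=> [j|t tB].
    by rewrite -H1; apply: eq_card => t; rewrite !inE tau_sh.
  by have := tau_sh v t; rewrite H2 //; case: (sh v t).
have sh_aff v : v \in typed_set tau B k -> aff B a0 a v = 0%R -> aff B a0 a (sh v) != 0%R.
  case/typed_setP => H1 H2 H.
  have : 0 < colour_count tau v i by rewrite H1.
  rewrite card_gt0 => /set0Pn[t0 Ht0]; rewrite /sh /pos; case: pickP => [u Hu|/(_ t0)]; last first.
    by rewrite inE in Ht0; rewrite Ht0.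
  have uB : u \in B by apply: contraTT Hu => /H2 ->.
  case E : (v u) Hu => [c|//]; rewrite -[_ == _]/(tau c == i) => ic /=.
  apply: contra_eq_neq H => H; rewrite -(subr0 (aff _ _ _ v)) -[X in (_ - X)%R]H.
  rewrite /aff (bigD1 u) //= [X in (_ - (_ + X))%R](bigD1 u) //= update_eq E /=.
  under [X in (_ - (_ + (_ + X)))%R]eq_bigr => t /andP[_ /negPf tu].
    rewrite ffunE tu; over.
  rewrite (_ : (_ - _ = alpha * (val c - val (sg c)))%R); last by rewrite aE //; ring.
  rewrite mulf_neq0 // subr_eq0 (inj_eq val_inj) eq_sym /sg ic.
  by rewrite next_neq ?me // -cardE.
rewrite -(cardsID [set v | aff B a0 a v != 0%R]) mul2n -addnn leq_add //.
  by apply: subset_leq_card; apply/subsetP => v; rewrite in_setI !(in_set (fun _ => _)).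
rewrite -(card_imset _ sh_inj); apply: subset_leq_card; apply/subsetP => w.
case/imsetP => v + ->; rewrite in_setD in_set negbK => /andP[/eqP H vW].
by rewrite in_set sh_W //= sh_aff.
Qed.

(** * Families whose coordinates outside [B] are affine forms in those of [B] *)

Variables (k : 'I_s -> nat) (X : {set {ffun T -> option C}}) (B : {set T}).
Variables (a0 : T -> F) (a : T -> T -> F).
Hypothesis cntX : forall v, v \in X -> forall i, colour_count tau v i = k i.
Hypothesis affX : forall v, v \in X -> forall j, j \notin B ->
  ov (v j) = aff B (a0 j) (a j) v.

Let K := \sum_i k i.
Let Xfull := [set v in X | supp v \subset B].

Lemma supp_res v : supp (restrict B v) = supp v :&: B.
Proof. by apply/setP => t; rewrite !inE ffunE andbC; case: (t \in B). Qed.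

Lemma res_inj : {in X &, injective (restrict B)}.
Proof.
move=> v w vX wX E; have EB t : t \in B -> v t = w t.
  by move=> tB; have := congr1 (fun f : {ffun _} => f t) E; rewrite !ffunE tB.
apply/ffunP => t; case: (boolP (t \in B)) => [|tB]; first exact: EB.
apply: ov_inj; rewrite !affX // /aff; congr (_ + _)%R.
by apply: eq_bigr => u uB; rewrite EB.
Qed.

Lemma card_suppX v : v \in X -> #|supp v| = K.
Proof. by move=> vX; rewrite (card_supp tau); apply: eq_bigr => i _; exact: cntX. Qed.

Lemma Xfull_W v : v \in Xfull -> v \in typed_set tau B k.
Proof.
by rewrite !in_set => /andP[vX ->]; rewrite andbT; apply/forallP => i; rewrite cntX.
Qed.

Lemma Xfull_aff v j : v \in Xfull -> j \notin B -> aff B (a0 j) (a j) v = 0%R.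
Proof.
move=> vf jB; have /typed_setP[_ /(_ _ jB) E] := Xfull_W vf.
by move: vf; rewrite in_set => /andP[vX _]; rewrite -affX // E.
Qed.

(** Full vectors have entry 0 at [j], hence are zeros of the form of [j]. *)
Lemma card_Xfull j : j \notin B ->
  #|Xfull| + #|[set v in typed_set tau B k | aff B (a0 j) (a j) v != 0%R]| <= #|typed_set tau B k|.
Proof.
move=> jB; rewrite -[leqRHS](cardsID [set v | aff B (a0 j) (a j) v == 0%R]) leq_add //.
  apply: subset_leq_card; apply/subsetP => v vf; rewrite in_setI Xfull_W // in_set.
  by rewrite (Xfull_aff vf jB) eqxx.
apply: subset_leq_card; apply/subsetP => v; rewrite in_set => /andP[vW vn].
by rewrite in_setD vW andbT in_set.
Qed.

Lemma card_Xfull_le : #|Xfull| <= #|typed_set tau B k|.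
Proof. by apply: subset_leq_card; apply/subsetP => v; exact: Xfull_W. Qed.

Lemma nonfull_lt v : v \in X -> ~~ (supp v \subset B) -> #|supp (restrict B v)| < K.
Proof.
move=> vX vB; rewrite -(card_suppX vX) supp_res proper_card // properE subsetIl /=.
by apply: contra vB => /subset_trans; apply; exact: subsetIr.
Qed.

Lemma card_res_lt q :
  #|[set v in X | #|supp (restrict B v)| < q]| <= geom_sum C #|B| q.
Proof.
apply: leq_trans (card_supp_lt C B q).
rewrite -[X in X <= _](card_in_imset (f := restrict B)); last first.
  by move=> v w; rewrite !in_set => /andP[vX _] /andP[wX _]; exact: (res_inj vX wX).
apply: subset_leq_card; apply/subsetP => w /imsetP[v]; rewrite [v \in _]in_set => /andP[_ vq] ->.
by rewrite in_set vq supp_res subsetIr.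
Qed.

Lemma card_X_crude : #|X| <= #|Xfull| + geom_sum C #|B| K.
Proof.
apply: leq_trans (leq_add (leqnn _) (card_res_lt K)).
apply: leq_trans (leq_card_setU _ _); apply: subset_leq_card; apply/subsetP => v vX.
rewrite in_setU !(in_set (fun _ => _)) vX /=.
by case: (boolP (supp v \subset B)) => //= /(nonfull_lt vX).
Qed.

(** The vectors with exactly one nonzero entry outside [B], since every support in [X] has size
    [K]. *)
Let X1 := [set v in X | #|supp (restrict B v)|.+1 == K].

Lemma card_X_fine : #|X| <= #|Xfull| + #|X1| + geom_sum C #|B| K.-1.
Proof.
apply: leq_trans (leq_add (leqnn _) (card_res_lt K.-1)).
apply: leq_trans (leq_trans (leq_card_setU _ _) (leq_add (leq_card_setU _ _) (leqnn _))).
apply: subset_leq_card; apply/subsetP => v vX.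
rewrite !in_setU !(in_set (fun _ => _)) vX /=.
case: (boolP (supp v \subset B)) => //= /(nonfull_lt vX); lia.
Qed.

Lemma X1_lower v : v \in X1 -> exists2 i, 0 < k i & restrict B v \in typed_set tau B (lower_type k i).
Proof.
rewrite in_set => /andP[vX /eqP vK].
have /eqP/cards1P[t Et] : #|supp v :\: B| = 1.
  by have := cardsID B (supp v); rewrite card_suppX // -vK supp_res; lia.
have tP u : (u \notin B) && (v u != None) = (u == t).
  by have /setP/(_ u) := Et; rewrite !inE.
have /andP[tB] : (t \notin B) && (v t != None) by rewrite tP.
case E: (v t) => [c|//] _.
have Ev : v = update (restrict B v) t (Some c).
  apply/ffunP => u; rewrite !ffunE; case: eqP => [->//|/eqP ut].
  case: ifP => // /negbT uB; have := tP u; rewrite uB (negPf ut) /=.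
  by move/negbT/negPn/eqP.
have rt : restrict B v t = None by rewrite ffunE (negPf tB).
have H i : k i = colour_count tau (restrict B v) i + (tau c == i).
  by rewrite -(cntX vX) [in LHS]Ev colour_count_update.
exists (tau c); first by rewrite H eqxx addn1.
apply/typed_setP; split=> [i|u uB]; last by rewrite ffunE (negPf uB).
by rewrite /lower_type H eq_sym addnK.
Qed.

(** The restriction to [B] determines the outer entry, so no factor [colour_mult tau i] occurs, in
    contrast to [card_typed_set_nonzero_zero]. Restrictions that are nonzero at [b] or [b'] are
    covered by the last summand. *)
Lemma card_X1 b b' :
  #|X1| <= \sum_i (if 0 < k i then #|typed_set tau (B :\ b' :\ b) (lower_type k i)| else 0)
           + 2 * (#|C| * geom_sum C #|B| K.-1).
Proof.
pose E b := [set w in weight_set C B K.-1 | w b != None].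
pose U := \bigcup_(i | 0 < k i) typed_set tau (B :\ b' :\ b) (lower_type k i).
rewrite -[X in X <= _](card_in_imset (f := restrict B)); last first.
  by move=> v w; rewrite !in_set => /andP[vX _] /andP[wX _]; exact: (res_inj vX wX).
apply: (@leq_trans #|U :|: (E b :|: E b')|).
  apply: subset_leq_card; apply/subsetP => w /imsetP[v vX1 ->].
  have [i ki /typed_setP[H1 H2]] := X1_lower vX1.
  have vS : restrict B v \in weight_set C B K.-1.
    by rewrite in_set supp_res subsetIr -supp_res; move: vX1; rewrite in_set => /andP[_ /eqP <-] /=.
  have EP c : (restrict B v \in E c) = (restrict B v c != None) by rewrite in_set vS.
  rewrite !in_setU !EP.
  case: eqP => //= vb; last by rewrite orbT.
  case: eqP => //= vb'; last by rewrite orbT.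
  rewrite orbF; apply/bigcupP; exists i => //; apply/typed_setP; split=> // t.
  by rewrite !inE !negb_and !negbK => /or3P[/eqP->|/eqP->|/H2].
apply: leq_trans (leq_card_setU _ _) _; apply: leq_add.
  rewrite -big_mkcond /= /U; elim/big_rec2: _ => [|i n V ki IH]; first by rewrite cards0.
  by apply: leq_trans (leq_card_setU _ _) _; rewrite leq_add2l.
apply: leq_trans (leq_card_setU _ _) _; rewrite mul2n -addnn.
by apply: leq_add; exact: card_weight_set_at.
Qed.

(* The right-hand sum counts the vectors of weight [K - 1] on [B] that vanish at
   [b] and [b']; those that do not vanish there go into the error term. *)
Lemma card_X_swap j b b' :
  j \notin B -> b \in B -> b' \in B -> a j b != a j b' ->
  #|X| + \sum_i colour_mult tau i * (if 0 < k i then Lk_count tau (lower_type k i) (#|B| - 2) else 0)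
  <= Lk_count tau k #|B| + \sum_i (if 0 < k i then Lk_count tau (lower_type k i) (#|B| - 2) else 0)
     + (2 * #|C| + 1) * geom_sum C #|B| K.-1.
Proof.
move=> jB bB b'B ab; have bb' : b != b' by apply: contraNneq ab => ->.
have cB : #|B :\ b' :\ b| = #|B| - 2.
  rewrite (cardsD1 b' B) b'B (cardsD1 b (B :\ b')) !inE bb' bB /=; lia.
have := swap_fail k (a0 j) bB b'B ab; rewrite (card_typed_set_nonzero_zero k bB b'B bb').
have := card_X1 b b'; have := card_X_fine; have := card_Xfull jB.
have -> : \sum_i (if 0 < k i then #|typed_set tau (B :\ b' :\ b) (lower_type k i)| else 0) =
  \sum_i (if 0 < k i then Lk_count tau (lower_type k i) (#|B| - 2) else 0).
  by apply: eq_bigr => i _; case: ifP => // _; rewrite card_typed_set cB.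
have -> : \sum_i colour_mult tau i * (if 0 < k i then #|typed_set tau (B :\ b' :\ b) (lower_type k i)| else 0) =
  \sum_i colour_mult tau i * (if 0 < k i then Lk_count tau (lower_type k i) (#|B| - 2) else 0).
  by apply: eq_bigr => i _; case: ifP => // _; rewrite card_typed_set cB.
rewrite card_typed_set; nia.
Qed.

End FixedT.

Variable k : 'I_s -> nat.
Hypothesis k_gt0 : forall i, 0 < k i.
Hypothesis ncol_gt0 : forall i, 0 < colour_mult tau i.
Let K := \sum_i k i.

Lemma lower_ge_bin (i : 'I_s) m : 'C(m, K.-1) <= Lk_count tau (lower_type k i) m.
Proof. by rewrite /K -(sum_lower (k_gt0 i)); exact: bin_le_Lk_count. Qed.

Lemma sum_lower_gt0 (f : 'I_s -> nat) (g : 'I_s -> nat) :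
  \sum_i f i * (if 0 < k i then g i else 0) = \sum_i f i * g i.
Proof. by apply: eq_bigr => i _; rewrite k_gt0. Qed.

Lemma sum_lower_gt01 (g : 'I_s -> nat) :
  \sum_i (if 0 < k i then g i else 0) = \sum_i g i.
Proof. by apply: eq_bigr => i _; rewrite k_gt0. Qed.

(** * Few vectors or small support *)

Section Dichotomy.

Variables (T : finType) (X : {set {ffun T -> option C}}) (B : {set T}).
Variables (a0 : T -> F) (a : T -> T -> F).
Hypothesis cntX : forall v, v \in X -> forall i, colour_count tau v i = k i.
Hypothesis affX : forall v, v \in X -> forall j, j \notin B ->
  ov (v j) = aff B (a0 j) (a j) v.
Implicit Types v : {ffun T -> option C}.
Hypothesis B_gt0 : 0 < #|B|.

(** In the second case an outer coordinate depends on the vector only through its coordinate sum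
    over [B], see [aff_const]. *)
Lemma swap_or_const :
  (exists j b b', [/\ j \notin B, b \in B, b' \in B & a j b != a j b']) \/
  (exists alpha, forall j, j \notin B -> forall t, t \in B -> a j t = alpha j).
Proof.
have [/existsP[j /existsP[b /existsP[b' /and4P[? ? ? ?]]]]|H] :=
  boolP [exists j, exists b, exists b', [&& j \notin B, b \in B, b' \in B & a j b != a j b']].
  by left; exists j, b, b'.
right; have [b bB] := card_gt0P B_gt0.
exists (fun j => a j b) => j jB t tB; apply/eqP; apply: contraNT H => H.
by apply/existsP; exists j; apply/existsP; exists t; apply/existsP; exists b; rewrite jB tB bB.
Qed.

Lemma aff_const (j : T) (alpha : F) v :
  (forall t, t \in B -> a j t = alpha) ->
  aff B (a0 j) (a j) v = (a0 j + alpha * \sum_(t in B) ov (v t))%R.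
Proof.
by move=> H; rewrite /aff mulr_sumr; congr (_ + _)%R; apply: eq_bigr => t /H ->.
Qed.

Lemma nonfull_outer v : ~~ (supp v \subset B) -> exists2 j, j \notin B & v j != None.
Proof. by case/subsetPn => j; rewrite inE => vj jB; exists j. Qed.

Lemma ov_eq0 d : (ov d == 0%R) = (d == None).
Proof. by case: d => [c|]; rewrite /= ?eqxx // (negPf (val_neq0 c)). Qed.

Lemma lt_of_no_full m : 'C(#|B| - 2, K) <= m -> geom_sum C #|B| K < 'C(#|B| - 2, K) ->
  #|[set v in X | supp v \subset B]| = 0 -> #|X| < m.
Proof.
move=> H1 H2 H3; have := card_X_crude cntX affX; rewrite H3 -/K; lia.
Qed.

(** A class with two values makes any nonzero outer coordinate too costly: the form attached to it,
    or one with unequal coefficients, excludes more full vectors than the vectors that are not full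
    can replace. *)
Lemma small_or_supported (i : 'I_s) : 1 < colour_mult tau i ->
  2 * geom_sum C #|B| K < 'C(#|B| - 2, K) ->
  (2 * #|C| + 1) * geom_sum C #|B| K.-1 < 'C(#|B| - 2, K.-1) ->
  #|X| < Lk_count tau k #|B| \/ forall v, v \in X -> supp v \subset B.
Proof.
move=> ci G1 G2; have [XB|] := boolP [forall v in X, supp v \subset B].
  by right; apply/forall_inP.
rewrite negb_forall_in => /exists_inP[v0 v0X /nonfull_outer[j jB v0j]]; left.
have GL : 'C(#|B| - 2, K) <= Lk_count tau k #|B|.
  by apply: leq_trans (bin_le_Lk_count _ _ ncol_gt0); apply: leq_bin2l; lia.
case: swap_or_const => [[j' [b [b' [j'B bB b'B ab]]]]|[alpha aE]].
  have := card_X_swap cntX affX j'B bB b'B ab.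
  rewrite sum_lower_gt0 sum_lower_gt01 -/K.
  (* The term of class [i] has a factor at least 2 on the left and 1 on the right; the surplus is at
     least ['C(#|B| - 2, K.-1)] and beats the error. *)
  rewrite (bigD1 i) //= [in X in _ <= X](bigD1 i) //=.
  set S1 := \sum_(_ | _) _; set S2 := \sum_(_ | _) _ => H.
  have S12 : S2 <= S1 by apply: leq_sum => l _; rewrite leq_pmull.
  have HL := lower_ge_bin i (#|B| - 2).
  have := leq_mul ci (leqnn (Lk_count tau (lower_type k i) (#|B| - 2))).
  move: H G2; set P := (_ + 1) * _; set N := colour_mult _ _ * _; lia.
(* If [alpha j = 0], the form of [j] is constant and nonzero, as [v0] shows, so [X] has no full
   vector. *)
have [al0|al0] := eqVneq (alpha j) 0%R.
  apply: (lt_of_no_full GL); first by apply: leq_ltn_trans G1; rewrite leq_pmull.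
  apply/eqP; rewrite cards_eq0; apply/eqP/setP => v; rewrite in_set0.
  apply/negP => vf; have := Xfull_aff cntX affX vf jB.
  have := affX v0X jB; rewrite -/aff !(aff_const _ (aE j jB)) al0 !mul0r => <- /eqP.
  by rewrite ov_eq0 (negPf v0j).
(* Now at most half of the typed vectors are full members of [X]; the factor 2 in [G1] lets the
   other half outweigh the remaining vectors. *)
have := shift_fail (a0 j) (aE j jB) al0 (k_gt0 i) ci.
have := card_X_crude cntX affX.
have := card_Xfull cntX affX jB; rewrite card_typed_set -/K; lia.
Qed.

(** The bound refers to one position more than [B], and the growth [LS] absorbs the errors. This
    position is needed when a single outer coordinate occurs. *)
Lemma small_or_supportedS : 0 < s ->
  geom_sum C #|B| K < 'C(#|B| - 2, K) ->
  (2 * #|C| + 1) * geom_sum C #|B| K.-1 < 'C(#|B| - 2, K.-1) ->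
  #|X| < Lk_count tau k #|B|.+1 \/
  exists2 P : {set T}, #|P| <= #|B|.+1 & forall v, v \in X -> supp v \subset P.
Proof.
move=> s0 G1 G2.
have LS := Lk_countS_ge #|B| ncol_gt0 k_gt0 s0.
have GL : 'C(#|B| - 2, K) <= Lk_count tau k #|B|.+1.
  by apply: leq_trans (bin_le_Lk_count _ _ ncol_gt0); apply: leq_bin2l; lia.
have CS : 'C(#|B| - 2, K.-1) <= 'C(#|B|, K.-1) by apply: leq_bin2l; lia.
case: swap_or_const => [[j' [b [b' [j'B bB b'B ab]]]]|[alpha aE]].
  left; have := card_X_swap cntX affX j'B bB b'B ab.
  rewrite sum_lower_gt0 sum_lower_gt01 -/K.
  set S1 := \sum_i colour_mult _ _ * _; set S2 := \sum_i Lk_count _ _ _ => H.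
  have S12 : S2 <= S1 by apply: leq_sum => l _; rewrite leq_pmull.
  move: LS; rewrite -/K; lia.
have [Xf0|/set0Pn[v0 v0f]] := eqVneq [set v in X | supp v \subset B] set0.
  by left; apply: lt_of_no_full GL G1 _; rewrite Xf0 cards0.
(* All forms vanish at the full vector [v0]; subtracting these values removes the constants [a0 j]
   and leaves multiples of the single form [h]. *)
pose h v : F := (\sum_(t in B) ov (v t) - \sum_(t in B) ov (v0 t))%R.
have hE v j : v \in X -> j \notin B -> ov (v j) = (alpha j * h v)%R.
  move=> vX jB; have := Xfull_aff cntX affX v0f jB; rewrite affX // -/aff.
  rewrite !(aff_const _ (aE j jB)) => E; rewrite -[LHS]subr0 -[X in (_ - X)%R = _]E /h; ring.
pose Z := [set j | (j \notin B) && (alpha j != 0%R)].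
have [Z1|/card_gt1P[j [j' [jZ j'Z jj']]]] := leqP #|Z| 1.
  right; exists (B :|: Z).
    by apply: leq_trans (leq_card_setU _ _) _; rewrite -addn1 leq_add2l.
  move=> v vX; apply/subsetP => t; rewrite !inE => vt.
  have [//|tB /=] := boolP (t \in B); apply: contraNneq vt => al0.
  by rewrite -ov_eq0 hE // al0 mul0r.
left; move: jZ j'Z; rewrite !inE => /andP[jB aj] /andP[j'B aj'].
(* A nonzero outer entry forces [h v] to be nonzero, and then [v] is nonzero at both [j] and
   [j']. *)
have X10 : #|[set v in X | #|supp (restrict B v)|.+1 == K]| = 0.
  apply/eqP; rewrite cards_eq0; apply/eqP/setP => v; rewrite in_set0 in_set.
  apply/negP => /andP[vX]; rewrite supp_res /K -(card_suppX cntX vX) -(cardsID B (supp v)).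
  rewrite -addn1 eqn_add2l eq_sym => /cards1P[t Et].
  have tP u : (u \notin B) && (v u != None) = (u == t).
    by have /setP/(_ u) := Et; rewrite !inE.
  have hv : h v != 0%R.
    have := tP t; rewrite eqxx -ov_eq0 => /andP[tB]; rewrite hE //.
    by apply: contraNneq => ->; rewrite mulr0.
  move: jj'; have /eqP -> : j == t by rewrite -tP jB -ov_eq0 hE ?mulf_neq0.
  by have /eqP -> : j' == t; rewrite ?eqxx // -tP j'B -ov_eq0 hE ?mulf_neq0.
have := card_X_fine cntX affX; rewrite -/K X10.
have := card_Xfull_le B cntX; rewrite card_typed_set.
move: LS; rewrite -/K; lia.
Qed.

End Dichotomy.
End Extremal.

(** * Affine rank as matrix rank *)

Section AffineRank.
Variables (F : fieldType) (n : nat).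
Implicit Types X T : {fset 'rV[F]_n}.
Local Open Scope ring_scope.

Definition coord_mx X : 'M[F]_(#|` X|%fset, n) :=
  \matrix_(l, j) (nth 0 (enum_fset X) l) 0 j.

(** The column of ones encodes the condition that the coefficients sum to 0, so the nonzero elements
    of the left kernel are the a-dependences. *)
Definition affine_mx X : 'M[F]_(#|` X|%fset, 1 + n) :=
  row_mx (const_mx 1) (coord_mx X).

Lemma affine_mx_eq0 X (y : 'rV[F]_(#|` X|%fset)) :
  (y *m affine_mx X = 0) <->
  (\sum_l y 0 l = 0 /\ \sum_l y 0 l *: nth 0 (enum_fset X) l = 0).
Proof.
have H1 : (y *m (const_mx 1 : 'M_(_, 1)) = 0) <-> (\sum_l y 0 l = 0).
  have E j : (y *m (const_mx 1 : 'M_(_, 1))) 0 j = \sum_l y 0 l.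
    by rewrite mxE; apply: eq_bigr => l _; rewrite mxE mulr1.
  split=> [H|H]; first by rewrite -(E 0) H mxE.
  by apply/rowP => j; rewrite E H mxE.
have H2 : y *m coord_mx X = \sum_l y 0 l *: nth 0 (enum_fset X) l.
  apply/rowP => j; rewrite mxE summxE; apply: eq_bigr => l _.
  by rewrite !mxE.
rewrite /affine_mx mul_mx_row H2; split=> [|[/H1 -> ->]]; last exact: row_mx0.
by rewrite -(@row_mx0 _ 1 1 n) => /eq_row_mx[/H1].
Qed.

Lemma a_dependent_of_rank T : (\rank (affine_mx T) < #|` T|%fset)%N -> a_dependent T.
Proof.
move=> rT; have : kermx (affine_mx T) != 0 by rewrite kermx_eq0 /row_free neq_ltn rT.
case/rowV0Pn => y /sub_kermxP/affine_mx_eq0[y1 y2] /rV0Pn[l0 yl0].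
pose c (v : 'rV[F]_n) := if insub (index v (enum_fset T)) is Some l then y 0 l else 0.
have cE (l : 'I_(#|` T|%fset)) : c (nth 0 (enum_fset T) l) = y 0 l.
  by rewrite /c index_uniq ?fset_uniq // valK.
exists c; split.
- by exists (nth 0 (enum_fset T) l0); rewrite ?cE // mem_nth.
- by rewrite (big_nth 0) big_mkord -[RHS]y2; apply: eq_bigr => l _; rewrite cE.
- by rewrite (big_nth 0) big_mkord -[RHS]y1; apply: eq_bigr => l _; rewrite cE.
Qed.

Lemma arank_le X r :
  (forall T, (T `<=` X)%fset -> (\rank (affine_mx T) <= r)%N) -> (arank X <= r)%N.
Proof.
move=> H; rewrite /arank; case: ex_minnP => m _; apply; apply/asboolP => T TX cT.
by apply: a_dependent_of_rank; rewrite [leqRHS]cT ltnS H.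
Qed.

(** Otherwise [(arank X).+1] of the rows are independent, and the corresponding vectors of [X] admit
    no a-dependence. *)
Lemma rank_le_arank X : (\rank (affine_mx X) <= arank X)%N.
Proof.
have : all_a_dependent X (arank X).+1.
  by rewrite /arank; case: ex_minnP => m /asboolP.
rewrite leqNgt; set p := (arank X).+1 => dep; apply/negP => Hp.
pose g (i : 'I_p) := maxrankfun (affine_mx X) (widen_ord Hp i).
pose e (l : 'I_(#|` X|%fset)) : 'rV[F]_n := nth 0 (enum_fset X) l.
have e_inj : injective e.
  by move=> l l' /eqP; rewrite nth_uniq ?fset_uniq // => /eqP/val_inj.
have eg_inj : injective (e \o g).
  move=> i i' /e_inj /maxrankfun_inj /(congr1 val) /= E; exact: val_inj.
pose sq := [seq (e \o g) i | i <- enum 'I_p].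
pose T := [fset x in sq]%fset.
have permT : perm_eq (enum_fset T) sq.
  apply: uniq_perm; rewrite ?fset_uniq //; first by rewrite map_inj_uniq ?enum_uniq.
  by move=> x; rewrite inE.
have TX : (T `<=` X)%fset.
  apply/fsubsetP => x; rewrite inE => /mapP[i _ ->]; exact: mem_nth.
have cT : #|` T|%fset = p by rewrite (perm_size permT) size_map -cardE card_ord.
have [c [[v0 v0T cv0] c1 c2]] := dep T TX cT.
(* The coefficients [c], extended by zero to all rows of the maximal independent family. *)
pose y : 'rV[F]_(\rank (affine_mx X)) :=
  \row_i (if (i < p)%N then c (e (maxrankfun (affine_mx X) i)) else 0).
have sumT (G : 'rV[F]_n -> F) :
    \sum_i y 0 i * G (e (maxrankfun (affine_mx X) i)) = \sum_(v <- T) c v * G v.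
  rewrite (perm_big _ permT) big_map big_enum /= -(big_ord_narrow
    (F := fun i => c (e (maxrankfun (affine_mx X) i)) * G (e (maxrankfun (affine_mx X) i))) Hp).
  rewrite [RHS]big_mkcond /=.
  by apply: eq_bigr => i _; rewrite mxE; case: ifP => _; rewrite ?mul0r.
have y0 : y = 0.
  apply: (row_free_inj (maxrowsub_free (affine_mx X))); rewrite /= mul0mx.
  apply/rowP => j; rewrite !mxE.
  case: (split_ordP j) => j' ->.
    transitivity (\sum_(v <- T) c v * 1); last by rewrite -mulr_suml c2 mul0r.
    rewrite -sumT; apply: eq_bigr => i _; congr (_ * _); rewrite [LHS]mxE.
    by rewrite /affine_mx row_mxEl mxE.
  transitivity (\sum_(v <- T) c v * v 0 j').
    rewrite -sumT; apply: eq_bigr => i _; congr (_ * _); rewrite [LHS]mxE.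
    by rewrite /affine_mx row_mxEr mxE.
  have := congr1 (fun u : 'rV[F]_n => u 0 j') c1; rewrite summxE mxE => E; rewrite -[RHS]E.
  by apply: eq_bigr => v _; rewrite mxE.
move: v0T; rewrite inE => /mapP[i _ Ev0]; move: cv0; rewrite Ev0 => /eqP; apply.
by have := congr1 (fun u : 'rV[F]_ _ => u 0 (widen_ord Hp i)) y0; rewrite !mxE /= ltn_ord.
Qed.

(** Take a maximal set of coordinates that is independent together with the constant 1 as functions
    on [X]. The constant uses up one unit of rank, hence the strict bound on [#|B|]. *)
Lemma affine_basis X r : X != fset0 -> (arank X <= r)%N ->
  exists B : {set 'I_n}, (#|B| < r)%N /\ exists (a0 : 'I_n -> F) (a : 'I_n -> 'I_n -> F),
    forall v, v \in X -> forall j, j \notin B -> v 0 j = a0 j + \sum_(t in B) a j t * v 0 t.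
Proof.
move=> X0 rX; pose N := #|` X|%fset.
have N0 : (0 < N)%N by rewrite cardfs_gt0.
pose R := (coord_mx X)^T.
pose one : 'M[F]_(1, N) := const_mx 1.
(* Rows outside [B] are zeroed rather than dropped, so that the matrix type does not depend on
   [B]. *)
pose mask (B : {set 'I_n}) : 'M[F]_(n, N) := \matrix_(t, l) (if t \in B then R t l else 0).
pose V B := (one + mask B)%MS.
have row_mask B t : row t (mask B) = if t \in B then row t R else 0.
  by apply/rowP => l; rewrite !mxE; case: ifP; rewrite ?mxE.
have P0 : (#|(set0 : {set 'I_n})| < \rank (V set0))%N.
  rewrite cards0 lt0n mxrank_eq0; apply/eqP => H.
  have : (one <= V set0)%MS by apply: addsmxSl.
  rewrite H submx0 => /eqP /matrixP /(_ 0 (Ordinal N0)).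
  by rewrite !mxE => /eqP; rewrite oner_eq0.
(* The condition says that the row of ones and the rows indexed by [B] are independent. *)
case: (@arg_maxnP _ set0 (fun B => #|B| < \rank (V B))%N (fun B => #|B|) P0) => B PB Bmax.
have span j : j \notin B -> (row j R <= V B)%MS.
  move=> jB; apply: contraT => H.
  have jV : (row j R <= V (j |: B))%MS.
    apply: submx_trans (addsmxSr _ _).
    by have := row_sub j (mask (j |: B)); rewrite row_mask !inE eqxx.
  have lt : (V B < V (j |: B))%MS.
    rewrite /ltmx; apply/andP; split; last by apply: contra H; apply: submx_trans.
    rewrite addsmx_sub addsmxSl /=; apply/row_subP => t; rewrite row_mask.
    case: ifP => tB; last exact: sub0mx.
    apply: submx_trans (addsmxSr _ _).
    by have := row_sub t (mask (j |: B)); rewrite row_mask !inE tB orbT.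
  have cjB : #|j |: B| = #|B|.+1 by rewrite cardsU1 jB.
  have := Bmax (j |: B); rewrite /= cjB ltnn; apply.
  exact: leq_ltn_trans PB (rank_ltmx lt).
exists B; split.
  apply: leq_trans (leq_trans PB _) rX; apply: leq_trans (rank_le_arank X).
  rewrite -[leqRHS]mxrank_tr /affine_mx tr_row_mx trmx_const; apply: mxrankS.
  apply: submx_trans (_ : (one + R <= _)%MS); last by rewrite addsmxE.
  rewrite addsmx_sub addsmxSl /=; apply/row_subP => t; rewrite row_mask.
  case: ifP => tB; last exact: sub0mx.
  by apply: submx_trans (addsmxSr _ _); exact: row_sub.
have coef j : {u : F * 'rV[F]_n | j \notin B ->
    forall l, R j l = u.1 + \sum_(t in B) u.2 0 t * R t l}.
  have [jB|_] := boolP (j \notin B); last by exists (0, 0).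
  apply: cid; have /sub_addsmxP[u E] := span j jB; exists (u.1 0 0, u.2) => _ l.
  have := congr1 (fun w : 'rV[F]_N => w 0 l) E; rewrite mxE => ->; rewrite !mxE.
  rewrite big_ord1 mxE mulr1; congr (_ + _); rewrite [RHS]big_mkcond /=.
  by apply: eq_bigr => t _; rewrite mxE; case: ifP => _; rewrite ?mulr0.
exists (fun j => (sval (coef j)).1), (fun j t => (sval (coef j)).2 0 t) => v vX j jB.
have lt_l : (index v (enum_fset X) < N)%N by rewrite index_mem.
have RE t : R t (Ordinal lt_l) = v 0 t by rewrite !mxE nth_index.
rewrite -RE (svalP (coef j) jB); congr (_ + _).
by apply: eq_bigr => t _; rewrite RE.
Qed.

Lemma arank_le_width X r : (n < r)%N -> (arank X <= r)%N.
Proof.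
by move=> nr; apply: arank_le => T _; apply: leq_trans (rank_leq_col _) _; rewrite add1n.
Qed.

(** A constant coordinate sum is a linear relation among the [1 + n] columns of the affine matrix,
    nontrivial as [n > 0]. It gains one over [arank_le_width]. *)
Lemma arank_le_relation X (c : F) : (0 < n)%N ->
  (forall v, v \in X -> \sum_j v 0 j = c) -> (arank X <= n)%N.
Proof.
move=> n0 H; apply: arank_le => T /fsubsetP TX.
pose z : 'M[F]_(1 + n, 1) := col_mx (const_mx (- c)) (const_mx 1).
have Mz : affine_mx T *m z = 0.
  rewrite mul_row_col; apply/matrixP => l j; rewrite !mxE big_ord1 !mxE mul1r.
  rewrite (eq_bigr (fun t => (nth 0 (enum_fset T) l) 0 t)); last by move=> t _; rewrite !mxE mulr1.
  by rewrite H ?addNr // TX // mem_nth.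
have : \rank (affine_mx T) != (1 + n)%N.
  apply/negP => /row_fullP[D D1].
  have : z = 0 by rewrite -[z]mul1mx -D1 -mulmxA Mz mulmx0.
  rewrite -(@col_mx0 _ 1 n 1) => /eq_col_mx[_ /matrixP /(_ (Ordinal n0) 0)].
  by rewrite !mxE => /eqP; rewrite oner_eq0.
by have := rank_leq_col (affine_mx T); lia.
Qed.

End AffineRank.

(** * Row vectors as coloured vectors *)

Section Encoding.
Variables (F : fieldType) (s : nat) (L : 'I_s -> {fset F}).
Hypothesis L_nonzero : forall i : 'I_s, (0%R : F) \notin L i.
Hypothesis L_disjoint : forall i j : 'I_s, i != j -> [disjoint L i & L j]%fset.

(** A nonzero value is stored with its class; disjointness of the [L i] makes [colour_val] injective
    all the same. *)
Definition colour : finType := {i : 'I_s & L i}.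

Definition colour_class (c : colour) : 'I_s := tag c.

Definition colour_val (c : colour) : F := fsval (tagged c).

Lemma colour_valP c : colour_val c \in L (colour_class c).
Proof. exact: fsvalP. Qed.

Lemma colour_ex i (x : F) : x \in L i -> exists c, colour_class c = i /\ colour_val c = x.
Proof. by move=> xL; exists (Tagged (fun i => L i : Type) [` xL]%fset). Qed.

Lemma L_inj i j (x : F) : x \in L i -> x \in L j -> i = j.
Proof.
move=> xi xj; apply/eqP; apply: contraT => /L_disjoint /fdisjointP /(_ x xi).
by rewrite xj.
Qed.

Lemma colour_val_inj : injective colour_val.
Proof.
move=> [i x] [j y] E; have ij : i = j.
  apply: (@L_inj _ _ (fsval x)); first exact: fsvalP.
  by rewrite -[fsval x]/(colour_val (existT _ i x)) E; exact: fsvalP.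
by subst j; congr existT; exact: val_inj.
Qed.

Lemma colour_val_neq0 c : colour_val c != 0%R.
Proof. by apply: contraTneq (colour_valP c) => ->. Qed.

Lemma colour_mult_colour i : colour_mult colour_class i = #|` L i|%fset.
Proof.
pose f (x : L i) : colour := Tagged (fun i => L i : Type) x.
have f_inj : injective f by move=> x y /(congr1 colour_val) /= E; exact: val_inj.
rewrite cardfE -(card_codom f_inj); apply: eq_card => c; rewrite inE.
apply/eqP/codomP => [|[x ->] //]; case: c => j x /= ji.
by rewrite /colour_class /= in ji; subst j; exists x.
Qed.

Local Notation cov := (ov colour_val).

Lemma ov_class i d : (cov d \in L i) = (omap colour_class d == Some i).
Proof.
case: d => [c|] /=; last by rewrite (negPf (L_nonzero i)).
apply/idP/eqP => [H|[<-]]; last exact: colour_valP.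
by congr Some; apply: L_inj H; exact: colour_valP.
Qed.

Definition decode n (w : {ffun 'I_n -> option colour}) : 'rV[F]_n := \row_j cov (w j).

Lemma dec_inj n : injective (@decode n).
Proof.
move=> v w /rowP E; apply/ffunP => j; have := E j; rewrite !mxE.
exact: (ov_inj colour_val_inj colour_val_neq0).
Qed.

Lemma card_dec_imfset n (W : {set {ffun 'I_n -> option colour}}) :
  #|` [fset decode w | w in W]%fset|%fset = #|W|.
Proof.
rewrite card_imfset /=; last exact: dec_inj.
by rewrite cardE; apply/perm_size/uniq_perm; rewrite ?enum_uniq ?enum_finmem_uniq // => w;
  rewrite mem_enum enum_finmemE.
Qed.

Lemma Lk_vector_dec n (k : 'I_s -> nat) (w : {ffun 'I_n -> option colour}) :
  Lk_vector L k (decode w) <-> forall i, colour_count colour_class w i = k i.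
Proof.
have E i : colour_count colour_class w i = #|[set j : 'I_n | decode w 0%R j \in L i]|.
  by apply: eq_card => j; rewrite !inE mxE ov_class.
split=> [[H _] i|H]; first by rewrite E.
split=> [i|j]; first by rewrite -E.
rewrite mxE; case: (w j) => [c|] /=; last by left.
by right; exists (colour_class c); exact: colour_valP.
Qed.

Lemma Lk_vector_decE n (k : 'I_s -> nat) (v : 'rV[F]_n) :
  Lk_vector L k v -> exists w, v = decode w.
Proof.
move=> [_ H]; exists [ffun j => [pick c | colour_val c == v 0%R j]].
apply/rowP => j; rewrite mxE ffunE; case: pickP => [c /eqP <- //|N] /=.
case: (H j) => [-> //|[i /colour_ex[c [_ E]]]].
by have := N c; rewrite /= E eqxx.
Qed.

Lemma set_of_family n (k : 'I_s -> nat) (X : {fset 'rV[F]_n}) :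
  (forall v, v \in X -> Lk_vector L k v) ->
  #|[set w | decode w \in X]| = #|` X|%fset.
Proof.
move=> XL; rewrite -card_dec_imfset; congr (#|` _|%fset); apply/fsetP => v.
apply/imfsetP/idP => [[w /= + ->]|vX]; first by rewrite inE.
by have [w Ew] := Lk_vector_decE (XL v vX); exists w; rewrite /= ?inE -?Ew.
Qed.

(** * Families of bounded affine rank *)

Section Dichotomy.

Variable k : 'I_s -> nat.
Hypothesis k_gt0 : forall i, 0 < k i.
Hypothesis L_neq0 : forall i, L i != fset0.
Hypothesis s_gt0 : 0 < s.
Let K := \sum_i k i.

Lemma colour_mult_colour_gt0 i : 0 < colour_mult colour_class i.
Proof. by rewrite colour_mult_colour cardfs_gt0. Qed.

Definition extremal_width r := if all_singletons L then r else r.-1.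

(** With the base [B] from [affine_basis], a large [B] falls under [small_or_supported] or
    [small_or_supportedS], while a small one bounds the family by a constant. *)
Lemma family_dichotomy : exists Q, forall r, Q <= r ->
  forall n (X : {fset 'rV[F]_n}), Lk_family L k r X ->
    #|` X|%fset < Lk_count colour_class k (extremal_width r) \/
    exists2 P : {set 'I_n}, #|P| <= extremal_width r &
      forall w, decode w \in X -> supp w \subset P.
Proof.
have K_gt0 : 0 < K by rewrite /K (bigD1 (Ordinal s_gt0)) //= addn_gt0 k_gt0.
(* The factors 2 and [2 * #|colour| + 1] are those in the hypotheses of [small_or_supported]. *)
have [Q1 H1] := bin_growth 2 #|colour| K.
have [Q2 H2] := bin_growth (2 * #|colour| + 1) #|colour| K.-1.
pose Q0 := maxn 1 (maxn Q1 Q2).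
(* This bounds any family with [#|B| < Q0]: it restricts injectively to vectors of weight at most
   [#|B|] on [B]. *)
pose A := \sum_(b < Q0) geom_sum colour b b.+1.
have [Q3 H3] := bin_growth A #|colour| K.
have c0 := colour_mult_colour_gt0.
exists (maxn Q3 1) => r; rewrite geq_max => /andP[/H3 Ar r0] n X [XL rX].
have {}Ar : A < Lk_count colour_class k (extremal_width r).
  apply: leq_trans (bin_le_Lk_count _ _ c0).
  apply: leq_ltn_trans (leq_trans Ar _); last by apply: leq_bin2l; rewrite /extremal_width; case: ifP; lia.
  by rewrite leq_pmulr // -(prednK K_gt0) big_ord_recl expn0.
pose Xs := [set w : {ffun 'I_n -> option colour} | decode w \in X].
rewrite -(set_of_family XL) -/Xs.
have cntX w : w \in Xs -> forall i, colour_count colour_class w i = k i.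
  by rewrite inE => /XL /Lk_vector_dec.
have [X0|X0] := eqVneq X fset0.
  left; rewrite (_ : Xs = set0) ?cards0 ?(leq_ltn_trans _ Ar) //.
  by apply/setP => w; rewrite inE X0 !inE.
have [B [Br [a0 [a aff_dec]]]] := affine_basis X0 rX.
have affX w : w \in Xs -> forall j, j \notin B ->
    cov (w j) = aff colour_val B (a0 j) (a j) w.
  rewrite inE => wX j jB; have := aff_dec _ wX j jB; rewrite mxE => ->.
  by congr (_ + _)%R; apply: eq_bigr => t _; rewrite mxE.
have vi := colour_val_inj; have v0 := colour_val_neq0.
have [BQ|BQ] := ltnP #|B| Q0.
  left; apply: leq_ltn_trans Ar; rewrite /A (bigD1 (Ordinal BQ)) //=.
  apply: leq_trans (leq_addr _ _); apply: leq_trans (card_res_lt vi v0 affX _).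
  apply: subset_leq_card; apply/subsetP => w wX; rewrite in_set wX /=.
  by rewrite ltnS supp_res subset_leq_card // subsetIr.
move: BQ; rewrite !geq_max => /and3P[B0 /H1 G1 /H2 G2].
have [/forallP LS|] := boolP (all_singletons L).
  have -> : extremal_width r = r by rewrite /extremal_width; case: ifP => // /negP[]; apply/forallP.
  have G1' : geom_sum colour #|B| K < 'C(#|B| - 2, K).
    by apply: leq_ltn_trans G1; rewrite leq_pmull.
  case: (small_or_supportedS vi v0 k_gt0 c0 cntX affX B0 s_gt0 G1' G2) => [lt|[P PB XP]].
    by left; apply: leq_trans lt _; exact: leq_Lk_count.
  right; exists P; first exact: leq_trans PB Br.
  by move=> w wX; apply: XP; rewrite inE.
move=> nLS; have -> : extremal_width r = r.-1 by rewrite /extremal_width (negPf nLS).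
move: nLS; rewrite negb_forall => /existsP[i Li].
have ci : 1 < colour_mult colour_class i.
  by rewrite ltn_neqAle eq_sym c0 andbT colour_mult_colour.
have Br' : #|B| <= r.-1 by lia.
case: (small_or_supported vi v0 k_gt0 c0 cntX affX B0 ci G1 G2) => [lt|XP].
  by left; apply: leq_trans lt _; exact: leq_Lk_count.
by right; exists B => // w wX; apply: XP; rewrite inE.
Qed.

Lemma family_bound : exists Q, forall r, Q <= r ->
  forall n (X : {fset 'rV[F]_n}), Lk_family L k r X ->
    #|` X|%fset <= Lk_count colour_class k (extremal_width r) /\
    (#|` X|%fset = Lk_count colour_class k (extremal_width r) ->
     exists P : {set 'I_n}, #|P| = extremal_width r /\
       forall v, v \in X -> forall j, j \notin P -> v 0%R j = 0%R).
Proof.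
have [Q HQ] := family_dichotomy; exists (maxn Q K.+2) => r.
rewrite geq_max => /andP[Qr Kr] n X fX; have [XL _] := fX.
case: (HQ r Qr n X fX) => [lt|[P Pr XP]].
  by split; [exact: ltnW | move=> E; rewrite E ltnn in lt].
have XN : #|` X|%fset <= Lk_count colour_class k #|P|.
  rewrite -(set_of_family XL) -card_typed_set; apply: subset_leq_card; apply/subsetP => w.
  rewrite inE => wX; rewrite inE XP // andbT; apply/forallP => i; apply/eqP.
  by have /Lk_vector_dec := XL _ wX.
split=> [|E]; first exact: leq_trans XN (leq_Lk_count _ _ Pr).
exists P; split; last first.
  move=> v vX j jP; have [w Ew] := Lk_vector_decE (XL v vX).
  rewrite Ew mxE; case wj : (w j) => [c|] //; case/negP: jP.
  by apply: (subsetP (XP w _)); rewrite ?inE ?wj // -Ew.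
(* A smaller [P] would hold too few vectors: [r >= K + 2] makes the binomial in [Lk_countS_ge]
   positive, so the last step up to [extremal_width r] strictly increases the count. *)
apply/eqP; rewrite eqn_leq Pr leqNgt; apply/negP => lt.
have opt_gt : K < extremal_width r by rewrite /extremal_width; case: ifP; lia.
have := Lk_countS_ge (extremal_width r).-1 colour_mult_colour_gt0 k_gt0 s_gt0.
rewrite (ltn_predK lt) -/K; have : 0 < 'C((extremal_width r).-1, K.-1) by rewrite bin_gt0; lia.
have : Lk_count colour_class k #|P| <= Lk_count colour_class k (extremal_width r).-1.
  by apply: leq_Lk_count; lia.
by move: XN; rewrite E; lia.
Qed.

End Dichotomy.

End Encoding.

(** * The value of the maximum and the extremal families *)

Theorem theorem4 (F : fieldType) (s : nat) (L : 'I_s -> {fset F})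
    (k : 'I_s -> nat)
    (L_nonzero : forall i : 'I_s, (0%R : F) \notin L i)
    (L_disjoint : forall i j : 'I_s, i != j -> [disjoint L i & L j]%fset)
    (k_pos : forall i : 'I_s, 0 < k i) :
  exists Q : nat, forall r : nat, Q <= r ->
    is_aex L r k
      (if all_singletons L then multinom r k else multinom r.-1 k * Lpow L k) /\
    (0 < s -> (forall i : 'I_s, L i != fset0) ->
     forall (n : nat) (X : {fset 'rV[F]_n}),
       Lk_family L k r X -> is_aex L r k #|` X|%fset ->
       exists P : {set 'I_n},
         #|P| = (if all_singletons L then r else r.-1) /\
         (forall v : 'rV[F]_n, v \in X ->
            forall j : 'I_n, j \notin P -> v 0%R j = 0%R)).
Proof.
set tau := @colour_class F s L.
pose opt r := if all_singletons L then r else r.-1.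
pose N m := Lk_count tau k m.
have NE r : (if all_singletons L then multinom r k else multinom r.-1 k * Lpow L k) = N (opt r).
  rewrite /N /opt /Lk_count /Lpow.
  have EL : \prod_i colour_mult tau i ^ k i = \prod_i #|` L i|%fset ^ k i.
    by apply: eq_bigr => i _; rewrite colour_mult_colour.
  rewrite EL; case: ifP => // /forallP H; rewrite big1 ?muln1 // => i _.
  by rewrite (eqP (H i)) exp1n.
have attained r : 0 < r ->
    exists (n : nat) (X : {fset 'rV[F]_n}), Lk_family L k r X /\ #|` X|%fset = N (opt r).
  (* Take all vectors of length [opt r]. Length [r - 1] gives affine rank at most [r] by width;
     length [r] does so for singletons because the coordinate sum is constant. *)
  move=> r0; exists (opt r), [fset decode w | w in typed_set tau [set: 'I_(opt r)] k]%fset.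
  have XP v : v \in [fset decode w | w in typed_set tau [set: 'I_(opt r)] k]%fset ->
      exists2 w, (forall i, colour_count tau w i = k i) & v = decode w.
    by case/imfsetP => w /= /typed_setP[H _] ->; exists w.
  split; last first.
    rewrite (card_dec_imfset L_nonzero L_disjoint (typed_set tau [set: 'I_(opt r)] k)).
    by rewrite card_typed_set cardsT card_ord.
  split=> [v /XP[w H ->]|]; first exact/Lk_vector_dec.
  rewrite /opt in XP *; case: ifP XP => [/forallP LS|_] XP; last first.
    by apply: arank_le_width; rewrite prednK.
  (* For a singleton [L i] this sum is its only element, so nothing has to be chosen. *)
  pose l i : F := (\sum_(x <- L i) x)%R.
  apply: (@arank_le_relation _ _ _ (\sum_i l i *+ k i)%R) => // v /XP[w H ->].
  have ovE d : ov (@colour_val _ _ L) d = (\sum_i l i *+ (omap tau d == Some i))%R.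
    case: d => [c|] /=; last by rewrite big1.
    rewrite (bigD1 (tau c)) //= eqxx big1 => [|i /negPf ic]; last first.
      by rewrite eq_sym [_ == _]ic.
    rewrite addr0 /l; have := colour_valP c; rewrite -/tau.
    have /cardfs1P[x Ex] := LS (tau c); rewrite Ex.
    by rewrite inE => /eqP ->; rewrite big_seq_fset1.
  rewrite (eq_bigr (fun j => \sum_i l i *+ (omap tau (w j) == Some i))%R); last first.
    by move=> j _; rewrite mxE ovE.
  rewrite exchange_big; apply: eq_bigr => i _; rewrite -H /colour_count -sum1_card.
  rewrite sumrMnr [in RHS]big_mkcond /=; congr (_ *+ _)%R.
  by apply: eq_bigr => j _; rewrite inE; case: eqP.
(* As [N (opt r)] is attained, an upper bound gives the maximum, and a family of maximum size has
   exactly [N (opt r)] vectors. *)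
suff [Q HQ] : exists Q, forall r, Q <= r ->
    forall n (X : {fset 'rV[F]_n}), Lk_family L k r X ->
    #|` X|%fset <= N (opt r) /\
    (0 < s -> (forall i, L i != fset0) -> #|` X|%fset = N (opt r) ->
     exists P : {set 'I_n}, #|P| = opt r /\
       forall v, v \in X -> forall j, j \notin P -> v 0%R j = 0%R).
  exists (maxn Q 1) => r; rewrite geq_max NE => /andP[Qr r0]; split.
    by split=> [|n X fX]; [exact: attained | have [] := HQ r Qr n X fX].
  move=> s0 L0 n X fX [_ Xmax]; have [leX eqX] := HQ r Qr n X fX.
  apply: eqX => //; apply/eqP; rewrite eqn_leq leX /=.
  by have [n' [X' [fX' <-]]] := attained r r0; exact: Xmax.
have [s0|s0] := posnP s.
  (* Without classes only the zero vector remains, and the count is at least ['C(opt r, 0) = 1]. *)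
  exists 0 => r _ n X [XL _]; split; last by [].
  have no_i (i : 'I_s) : False by case: i => m; rewrite s0.
  apply: (@leq_trans #|` [fset (0%R : 'rV[F]_n)]|%fset).
    apply: fsubset_leq_card; apply/fsubsetP => v /XL[_ H]; rewrite inE; apply/eqP/rowP => j.
    by rewrite mxE; case: (H j) => // -[i]; case: (no_i i).
  rewrite cardfs1 -(bin0 (opt r)); have <- : \sum_i k i = 0.
    by rewrite big1 // => i; case: (no_i i).
  by apply: bin_le_Lk_count => i; case: (no_i i).
have [/forallP L0|] := boolP [forall i, L i != fset0].
  have [Q HQ] := family_bound L_nonzero L_disjoint k_pos L0 s0.
  by exists Q => r Qr n X fX; have [? H] := HQ r Qr n X fX; split=> // _ _; exact: H.
(* If [L i] is empty, then [k i > 0] leaves no vector at all. *)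
rewrite negb_forall => /existsP[i /negPn/eqP Li]; exists 0 => r _ n X [XL _]; split.
  have -> : X = fset0; last by rewrite cardfs0.
  apply/fsetP => v; rewrite inE; apply/negP => /XL[/(_ i) + _].
  move=> E; have := k_pos i; rewrite -E card_gt0 => /set0Pn[j].
  by rewrite inE Li inE.
by move=> _ /(_ i); rewrite Li eqxx.
Qed.
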